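(* Let $(A,\sigma)$ be an $F$-algebra with involution, $P\in X_F$, and $\iota:F\to F_P$ a real closure of $F$ at $P$. Let $\mathscr{M}_1$ and $\mathscr{M}_2$ be two different Morita equivalences $\mathscr{H}(A\otimes_F F_P,\sigma\otimes\mathrm{id})\to\mathscr{H}_{\varepsilon_P}(D_P,\vartheta_P)$. Then there exists $\delta\in\{-1,1\}$ such that for every $h\in W(A,\sigma)$, $$\mathrm{sign}_\iota^{\mathscr{M}_1}h=\delta\,\mathrm{sign}_\iota^{\mathscr{M}_2}h .$$
   Context: **Algebras with involution and forms.** $F$ is a formally real field and $X_F$ is its space of orderings. An $F$-algebra with involution is a pair $(A,\sigma)$ with $A$ a finite-dimensional $F$-algebra and $\sigma:A\to A$ an $F$-linear map with $\sigma(xy)=\sigma(y)\sigma(x)$, $\sigma^2=\mathrm{id}$, such that either ($\sigma$ of the first kind) $A$ is simple with centre $F$, or ($\sigma$ of the second kind, or unitary) $A$ is simple with centre a quadratic field extension $F(\sqrt d)$ of $F$ on which $\sigma$ acts nontrivially. If $\sigma$ is of the first kind and $\dim_F A=m^2$, then $\sigma$ is orthogonal (resp. symplectic) if $\{a\in A:\sigma(a)=a\}$ has $F$-dimension $m(m+1)/2$ (resp. $m(m-1)/2$). For $\varepsilon\in\{-1,1\}$, an $\varepsilon$-hermitian form over a ring with involution $(A,\sigma)$ is a finitely generated right module $M$ (always projective here) with a biadditive $h:M\times M\to A$ such that $h(xa,yb)=\sigma(a)h(x,y)b$ and $h(y,x)=\varepsilon\sigma(h(x,y))$; hermitian means $\varepsilon=1$.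 All forms are assumed nonsingular. $\mathscr{H}_\varepsilon(A,\sigma)$ is the category of nonsingular $\varepsilon$-hermitian forms with isometries as morphisms, $W_\varepsilon(A,\sigma)$ the Witt group; the subscript is dropped when $\varepsilon=1$. **Signatures, real closed case.** Let $R$ be real closed. For a symmetric bilinear form over $R$, a hermitian form over $(R(\sqrt{-1}),-)$ (conjugation), or a hermitian form over $((-1,-1)_R,-)$ (quaternion conjugation), diagonalize as $\langle\alpha_1,\dots,\alpha_n\rangle$ with $\alpha_i\in\{-1,1\}$ and put $\mathrm{sign}=\sum\alpha_i$. For skew-symmetric forms over $R$, hermitian forms over $(R\times R,\text{exchange involution }(x,y)\mapsto(y,x))$ and skew-hermitian forms over $((-1,-1)_R,-)$, put $\mathrm{sign}=0$. **$M$-signature.** A real closure of $F$ at $P$ is a field embedding $\iota:F\to F_P$ with $F_P$ real closed, $\iota(P)\subseteq F_P^2$ and $F_P$ algebraic over $\iota(F)$. Tensor products with $F_P$ are along $\iota$. The algebra with involution $(A\otimes_F F_P,\sigma\otimes\mathrm{id})$ is (hermitian) Morita equivalent to $(D_P,\vartheta_P)$, where: if $\sigma$ is of the first kind, $(D_P,\vartheta_P)=(F_P,\mathrm{id})$ or $(H_P,-)$ with $H_P=(-1,-1)_{F_P}$, according to whether $A\otimes_F F_P$ is a matrix algebra over $F_P$ or over $H_P$; if $\sigma$ is unitary, $(D_P,\vartheta_P)=(F_P(\sqrt{-1}),-)$ if $d<_P0$ and $(F_P\times F_P,\text{exchange})$ if $d>_P0$. Put $\varepsilon_P=-1$ if one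 of $\sigma,\vartheta_P$ is orthogonal and the other symplectic ($\mathrm{id}$ on $F_P$ being orthogonal and $-$ on $H_P$ symplectic), $\varepsilon_P=1$ otherwise. A Morita equivalence $\mathscr{M}:\mathscr{H}(A\otimes_F F_P,\sigma\otimes\mathrm{id})\to\mathscr{H}_{\varepsilon_P}(D_P,\vartheta_P)$ is an equivalence of categories given by hermitian Morita theory; it respects isometries, orthogonal sums and hyperbolic forms and induces a group isomorphism of Witt groups, also denoted $\mathscr{M}$. For a hermitian form $h$ over $(A,\sigma)$, $\mathrm{sign}_\iota^{\mathscr{M}}h:=\mathrm{sign}\,\mathscr{M}(h\otimes F_P)$, where $h\otimes F_P=(\mathrm{id}_A\otimes\iota)^*(h)$. *)

(* Defs.v *)
From HB Require Import structures.
From mathcomp Require Import all_boot all_order all_algebra all_field.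
From mathcomp Require Import boolp classical_sets.
From mathcomp Require Import complex.
From mathcomp Require Import ring.

Set Implicit Arguments.
Unset Strict Implicit.
Unset Printing Implicit Defensive.

Import GRing.Theory.
Local Open Scope ring_scope.

Definition formally_real (F : fieldType) : Prop :=
  forall s : seq F, \sum_(x <- s) x ^+ 2 != -1.

Definition is_ordering (F : fieldType) (P : set F) : Prop :=
  [/\ forall x y, P x -> P y -> P (x + y),
      forall x y, P x -> P y -> P (x * y),
      forall x, P x \/ P (- x) &
      forall x, P x -> P (- x) -> x = 0].

(* The order of the [rcfType] is the only one it has, with the squares as its
   nonnegative elements, so it is no extra structure on the real closure. *)
Definition is_real_closure (F : fieldType) (P : set F) (FP : rcfType)
    (iota : {rmorphism F -> FP}) : Prop :=
  (forall x, P x -> exists y, iota x = y ^+ 2) /\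
  (forall y, algebraicOver iota y).

Section AlgebraWithInvolution.
Variables (F : fieldType) (A : falgType F) (sigma : {linear A -> A}).

Definition simple_ring (R : nzRingType) : Prop :=
  forall I : set R,
    I 0 -> (forall x y, I x -> I y -> I (x + y)) ->
    (forall a x, I x -> I (a * x)) -> (forall a x, I x -> I (x * a)) ->
    (forall x, I x -> x = 0) \/ (forall x, I x).

Definition first_kind : Prop := 'Z({:A})%VS = 1%VS.

(* The centre is [F(s)] with [s ^+ 2 = d] for a nonsquare [d]. *)
Definition second_kind (d : F) : Prop :=
  (forall x : F, x ^+ 2 <> d) /\
  exists s : A, [/\ s * s = d%:A, 'Z({:A})%VS = (1 + <[s]>)%VS
                  & exists2 z, z \in 'Z({:A})%VS & sigma z <> z].

Definition algebra_with_involution : Prop :=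
  [/\ simple_ring A,
      forall x y, sigma (x * y) = sigma y * sigma x,
      forall x, sigma (sigma x) = x &
      first_kind \/ exists d, second_kind d].

Definition orthogonal_inv : Prop :=
  first_kind /\ exists m : nat, \dim {:A} = (m ^ 2)%N /\
    \dim (fixedSpace (linfun sigma)) = (m * (m + 1) %/ 2)%N.

Definition symplectic_inv : Prop :=
  first_kind /\ exists m : nat, \dim {:A} = (m ^ 2)%N /\
    \dim (fixedSpace (linfun sigma)) = (m * (m - 1) %/ 2)%N.

End AlgebraWithInvolution.

(* Right R-modules are left modules over the converse ring. *)
Definition ract (R : pzRingType) (M : lmodType R^c) (x : M) (a : R) : M :=
  (a : R^c) *: x.
Notation "x <* a" := (ract x a) (at level 40, left associativity).

(* Tensor product, over R, of a right R-module M and a left R-module N, the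
   actions being given by [ra] and [la], by its universal property. *)
Section Tensor.
Variables (R : pzRingType) (M N : zmodType).
Variables (ra : M -> R -> M) (la : R -> N -> N).

Definition balanced (V : zmodType) (b : M -> N -> V) : Prop :=
  [/\ forall m m' n, b (m + m') n = b m n + b m' n,
      forall m n n', b m (n + n') = b m n + b m n' &
      forall m a n, b (ra m a) n = b m (la a n)].

Definition is_tensor (T : zmodType) (t : M -> N -> T) : Prop :=
  balanced t /\
  forall (V : zmodType) (b : M -> N -> V), balanced b ->
    exists f : {additive T -> V},
      (forall m n, f (t m n) = b m n) /\
      forall g : {additive T -> V}, (forall m n, g (t m n) = b m n) -> g =1 f.

End Tensor.

Section HermitianForms.
Variables (R : pzRingType) (sigma : R -> R) (eps : int).

Definition fg_projective (M : lmodType R^c) : Prop :=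
  exists (n : nat) (s : {linear M -> 'rV[R^c]_n}) (p : {linear 'rV[R^c]_n -> M}),
    cancel s p.

Definition eps_hermitian (M : lmodType R^c) (h : M -> M -> R) : Prop :=
  [/\ forall x y z, h (x + y) z = h x z + h y z,
      forall x y z, h x (y + z) = h x y + h x z,
      forall x y a b, h (x <* a) (y <* b) = sigma a * h x y * b &
      forall x y, h y x = sigma (h x y) *~ eps].

(* [x |-> h x _] is a bijection from M onto the dual module [Hom_R(M, R)]. *)
Definition nonsingular (M : lmodType R^c) (h : M -> M -> R) : Prop :=
  forall f : M -> R,
    (forall x y, f (x + y) = f x + f y) -> (forall x a, f (x <* a) = f x * a) ->
    exists! x, forall y, f y = h x y.

Record herm : Type := Herm {
  hmod :> lmodType R^c;
  hform : hmod -> hmod -> R;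
  _ : fg_projective hmod;
  _ : eps_hermitian hform;
  _ : nonsingular hform }.

Record isometry (h k : herm) : Type := Isometry {
  isom_fun :> {linear h -> k};
  isom_bij : bijective isom_fun;
  isom_form : forall x y, hform (isom_fun x) (isom_fun y) = hform x y }.

End HermitianForms.

(* [hS] is the base change of [h] along [j : R -> S]: its module is
   [h (x)_R S], with form
   [(m (x) s, m' (x) s') |-> tau s * j (h m m') * s']. *)
Definition is_base_change (R S : pzRingType) (sigma : R -> R) (tau : S -> S)
    (j : {rmorphism R -> S}) (eps : int)
    (h : herm sigma eps) (hS : herm tau eps) : Prop :=
  exists t : h -> S -> hS,
    [/\ is_tensor (@ract R h) (fun a s => j a * s) t,
        forall m s s', t m (s * s') = t m s <* s' &
        forall m m' s s',
          hform (t m s) (t m' s') = tau s * j (hform m m') * s'].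

Section Morita.
Variables (R S : pzRingType) (sigma : R -> R) (tau : S -> S) (eps : int).

(* An R-S-bimodule N, where R acts by [la], carrying a nonsingular
   eps-hermitian form over [(S, tau)] whose adjoint involution restricts to
   [sigma] on R; N is a progenerator over S and R is all of [End_S(N)]. *)
Definition morita_bimodule (N : herm tau eps) (la : R -> N -> N) : Prop :=
  [/\ (forall a x y, la a (x + y) = la a x + la a y) /\
      (forall a x s, la a (x <* s) = la a x <* s),
      [/\ forall a b x, la (a + b) x = la a x + la b x,
          forall a b x, la (a * b) x = la a (la b x) &
          forall x, la 1 x = x],
      forall f : N -> N,
        (forall x y, f (x + y) = f x + f y) ->
        (forall x s, f (x <* s) = f x <* s) -> exists! a, f =1 la a,
      exists (n : nat) (f : 'I_n -> N -> S) (x : 'I_n -> N),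
        [/\ forall i y z, f i (y + z) = f i y + f i z,
            forall i y s, f i (y <* s) = f i y * s &
            \sum_i f i (x i) = 1] &
      forall a x y, hform (la a x) y = hform x (la (sigma a) y)].

(* A functor between the categories of forms (with isometries as morphisms)
   that is an equivalence and is of the form
   [(M, h) |-> (M (x)_R N, (m (x) n, m' (x) n') |-> phi n (h m m' n'))]
   for a Morita bimodule [(N, phi)]. *)
Record morita_equivalence : Type := MoritaEquivalence {
  mor_obj :> herm sigma 1 -> herm tau eps;
  mor_map : forall h k, isometry h k -> isometry (mor_obj h) (mor_obj k);
  mor_id : forall h (f : isometry h h), f =1 id -> mor_map f =1 id;
  mor_comp : forall h k l (f : isometry h k) (g : isometry k l)
    (gf : isometry h l), gf =1 g \o f -> mor_map gf =1 mor_map g \o mor_map f;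
  mor_faithful : forall h k (f g : isometry h k),
    mor_map f =1 mor_map g -> f =1 g;
  mor_full : forall h k (g : isometry (mor_obj h) (mor_obj k)),
    exists f : isometry h k, mor_map f =1 g;
  mor_esssurj : forall k, exists h, inhabited (isometry (mor_obj h) k);
  mor_hermitian_morita :
    exists (N : herm tau eps) (la : R -> N -> N)
           (t : forall h : herm sigma 1, h -> N -> mor_obj h),
      [/\ morita_bimodule la,
          forall h : herm sigma 1, is_tensor (@ract R h) la (@t h),
          forall (h : herm sigma 1) m n s, t h m (n <* s) = t h m n <* s,
          forall (h : herm sigma 1) m m' n n',
            hform (t h m n) (t h m' n') = hform n (la (hform m m') n') &
          forall h k (f : isometry h k) m n,
            mor_map f (t h m n) = t k (f m) n] }.

End Morita.

(* The quaternion algebra [(-1, -1)_R]; [Quat a b c d] is [a + b i + c j + d k]. *)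
Record quat (R : Type) : Type := Quat { q1 : R; qi : R; qj : R; qk : R }.

Section Quaternions.

Definition quat_to_prod (R : Type) (x : quat R) : R * R * R * R :=
  (q1 x, qi x, qj x, qk x).
Definition prod_to_quat (R : Type) (x : R * R * R * R) : quat R :=
  let: (a, b, c, d) := x in Quat a b c d.
Lemma quat_to_prodK (R : Type) : cancel (@quat_to_prod R) (@prod_to_quat R).
Proof. by case. Qed.

HB.instance Definition _ (R : eqType) :=
  Equality.copy (quat R) (can_type (@quat_to_prodK R)).
HB.instance Definition _ (R : choiceType) :=
  Choice.copy (quat R) (can_type (@quat_to_prodK R)).

Variable R : comNzRingType.
Implicit Types x y : quat R.

Definition quat_zero : quat R := Quat 0 0 0 0.
Definition quat_one : quat R := Quat 1 0 0 0.
Definition quat_opp x := Quat (- q1 x) (- qi x) (- qj x) (- qk x).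
Definition quat_add x y :=
  Quat (q1 x + q1 y) (qi x + qi y) (qj x + qj y) (qk x + qk y).
Definition quat_mul x y :=
  Quat (q1 x * q1 y - qi x * qi y - qj x * qj y - qk x * qk y)
       (q1 x * qi y + qi x * q1 y + qj x * qk y - qk x * qj y)
       (q1 x * qj y - qi x * qk y + qj x * q1 y + qk x * qi y)
       (q1 x * qk y + qi x * qj y - qj x * qi y + qk x * q1 y).

Lemma quat_addA : associative quat_add.
Proof. by move=> x y z; rewrite /quat_add /= !addrA. Qed.
Lemma quat_addC : commutative quat_add.
Proof. by move=> x y; congr Quat; rewrite addrC. Qed.
Lemma quat_add0 : left_id quat_zero quat_add.
Proof. by case=> *; rewrite /quat_add /= !add0r. Qed.
Lemma quat_addN : left_inverse quat_zero quat_opp quat_add.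
Proof. by case=> *; rewrite /quat_add /= !addNr. Qed.

HB.instance Definition _ :=
  GRing.isZmodule.Build (quat R) quat_addA quat_addC quat_add0 quat_addN.

Lemma quat_mulA : associative quat_mul.
Proof. by move=> x y z; congr Quat => /=; ring. Qed.
Lemma quat_mul1l : left_id quat_one quat_mul.
Proof. by case=> *; congr Quat => /=; ring. Qed.
Lemma quat_mul1r : right_id quat_one quat_mul.
Proof. by case=> *; congr Quat => /=; ring. Qed.
Lemma quat_mulDl : left_distributive quat_mul +%R.
Proof. by move=> x y z; congr Quat => /=; ring. Qed.
Lemma quat_mulDr : right_distributive quat_mul +%R.
Proof. by move=> x y z; congr Quat => /=; ring. Qed.
Lemma quat_one_neq0 : quat_one != 0.
Proof. by apply/eqP => -[/eqP]; rewrite oner_eq0. Qed.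

HB.instance Definition _ := GRing.Zmodule_isNzRing.Build (quat R)
  quat_mulA quat_mul1l quat_mul1r quat_mulDl quat_mulDr quat_one_neq0.

Definition quat_conj x : quat R := Quat (q1 x) (- qi x) (- qj x) (- qk x).

End Quaternions.

Variant target : Type := TReal | TQuat | TComplex | TSplit.

Definition tring (K : rcfType) (T : target) : nzRingType :=
  match T with
  | TReal => K
  | TQuat => quat K
  | TComplex => complex K
  | TSplit => (K * K)%type
  end.

Definition tinv (K : rcfType) (T : target) : tring K T -> tring K T :=
  match T return tring K T -> tring K T with
  | TReal => fun x => x
  | TQuat => fun x => quat_conj x
  | TComplex => fun x => conjc x
  | TSplit => fun x => (x.2, x.1)
  end.

(* [alpha] is a diagonalization [<alpha_1, ..., alpha_n>] of the form [h]. *)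
Definition diagonalization (D : nzRingType) (theta : D -> D) (eps : int)
    (h : herm theta eps) (n : nat) (alpha : 'I_n -> int) : Prop :=
  (forall i, alpha i = 1 \/ alpha i = -1) /\
  exists f : {linear h -> 'rV[D^c]_n}, bijective f /\
    forall x y, hform x y =
      \sum_i theta (f x ord0 i : D) * (alpha i)%:~R * (f y ord0 i : D).

Definition sign_diag (D : nzRingType) (theta : D -> D) (eps : int)
    (h : herm theta eps) : int :=
  xget 0 [set s | exists (n : nat) (alpha : 'I_n -> int),
                    diagonalization h alpha /\ s = \sum_i alpha i].

Definition sign (K : rcfType) (T : target) (eps : int)
    (h : herm (@tinv K T) eps) : int :=
  match T with
  | TReal | TQuat => if eps == 1 then sign_diag h else 0
  | TComplex => sign_diag h
  | TSplit => 0
  end.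

Section ScalarExtension.
Variables (F : fieldType) (A : falgType F) (sigma : {linear A -> A}).
Variables (K : fieldType) (iota : {rmorphism F -> K}).
Variables (AK : algType K) (j : {rmorphism A -> AK}).

(* [AK], with [j a = a (x) 1], is [A (x)_F K] along [iota] as a K-algebra, and
   [sigmaK] is [sigma (x) id]. *)
Definition is_scalar_extension (sigmaK : {linear AK -> AK}) : Prop :=
  is_tensor (fun (a : A) (c : F) => c *: a) (fun (c : F) (x : K) => iota c * x)
            (fun a x => x *: j a) /\
  forall a x, sigmaK (x *: j a) = x *: j (sigma a).

End ScalarExtension.

(* [B] is isomorphic to some [M_n(D)] as a K-algebra, where [e : K -> D] is the
   structure map of the K-algebra D. *)
Definition is_matrix_algebra (K : fieldType) (B : algType K) (D : nzRingType)
    (e : K -> D) : Prop :=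
  exists (n : nat) (f : {rmorphism B -> 'M[D]_n.+1}),
    bijective f /\ forall x : K, f x%:A = (e x)%:M.

Definition is_target (F : fieldType) (P : set F) (A : falgType F)
    (sigma : {linear A -> A}) (K : rcfType) (AK : algType K) (T : target) :
    Prop :=
  match T with
  | TReal => first_kind A /\ is_matrix_algebra AK (fun x : K => x)
  | TQuat =>
      first_kind A /\ is_matrix_algebra AK (fun x : K => Quat x 0 0 0 : quat K)
  | TComplex => exists d, second_kind sigma d /\ P (- d)
  | TSplit => exists d, second_kind sigma d /\ P d
  end.

Definition eps_target (F : fieldType) (A : falgType F)
    (sigma : {linear A -> A}) (T : target) : int :=
  if `[< (orthogonal_inv sigma /\ T = TQuat) \/
         (symplectic_inv sigma /\ T = TReal) >] then -1 else 1.

(* Main.v *)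
From HB Require Import structures.
Require Import Defs.
From mathcomp Require Import all_boot all_order all_algebra all_field.
From mathcomp Require Import boolp classical_sets.
From mathcomp Require Import complex ring lra zify.

Set Implicit Arguments.
Unset Strict Implicit.
Unset Printing Implicit Defensive.

Import Order.TTheory GRing.Theory Num.Theory.
Local Open Scope ring_scope.

(* When the signature is not identically zero, [D_P] is a division ring whose
   involution is positive, so by Sylvester's law of inertia the isometry
   classes of forms over it form the free commutative monoid N^2 on <1> and
   <-1>.  A Morita equivalence is additive for orthogonal sums and bijective on
   isometry classes.  Comparing two of them thus gives an automorphism of N^2,
   which is the identity or the swap of the generators, and the signature
   [p - q] is preserved or negated accordingly.  No comparison of the
   underlying bimodules is needed. *)

(** * Maps out of tensor products *)

Lemma linear_bundle (R : pzRingType) (U V : lmodType R) (f : U -> V) :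
  linear f -> exists g : {linear U -> V}, g =1 f.
Proof.
move=> fL.
by exists (HB.pack_for {linear U -> V} f (GRing.isLinear.Build _ _ _ _ f fL)).
Qed.

(** Both maps factor the same balanced map, so uniqueness in the universal property identifies them.
    They are taken unbundled so that maps such as [hform z] can be compared directly. *)
Lemma tensor_ext (R : pzRingType) (M N : zmodType) (ra : M -> R -> M)
    (la : R -> N -> N) (T : zmodType) (t : M -> N -> T) (V : zmodType)
    (f g : T -> V) :
  is_tensor ra la t -> {morph f : x y / x + y} -> {morph g : x y / x + y} ->
  (forall m n, f (t m n) = g (t m n)) -> f =1 g.
Proof.
move=> [[tDl tDr tM] univ] fD gD fg.
have bB (k : T -> V) : {morph k : x y / x + y} -> zmod_morphism k.
  by move=> kD x y; apply: (addIr (k y)); rewrite -kD !subrK.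
pose f' : {additive T -> V} :=
  HB.pack f (GRing.isZmodMorphism.Build _ _ f (bB _ fD)).
pose g' : {additive T -> V} :=
  HB.pack g (GRing.isZmodMorphism.Build _ _ g (bB _ gD)).
have [|k [kt kuniq]] := univ V (fun m n => f (t m n)).
  by split=> *; rewrite ?tDl ?tDr ?tM ?fD.
by move=> x; rewrite -[f x]/(f' x) -[g x]/(g' x) (kuniq f') // (kuniq g').
Qed.

Lemma tensor_linear (R : pzRingType) (S : pzRingType) (M : zmodType)
    (N : lmodType S^c) (ra : M -> R -> M)
    (la : R -> N -> N) (T V : lmodType S^c) (t : M -> N -> T) (b : M -> N -> V) :
  is_tensor ra la t -> (forall m n s, t m (n <* s) = t m n <* s) ->
  balanced ra la b -> (forall m n s, b m (n <* s) = b m n <* s) ->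
  exists f : {linear T -> V}, forall m n, f (t m n) = b m n.
Proof.
move=> tT ts bB bs; have [f [ft _]] := tT.2 V b bB.
have fZ : scalable f.
  move=> s; apply: (tensor_ext tT) => [x y|x y|m n].
  - by rewrite scalerDr raddfD.
  - by rewrite raddfD scalerDr.
  have := ts m n s; rewrite /ract => <-.
  by have := bs m n s; rewrite !ft /ract => ->.
pose f' : {linear T -> V} :=
  HB.pack (f : T -> V) (GRing.isScalable.Build _ _ _ _ (f : T -> V) fZ)
    (GRing.Additive.class f).
by exists f'.
Qed.

(** * Elementary rules for hermitian forms *)

Section HermFacts.
Variables (R : pzRingType) (sigma : R -> R) (eps : int) (h : herm sigma eps).

Lemma herm_fg_projective : fg_projective h.
Proof. by case: h. Qed.

Lemma hform_hermitian : eps_hermitian sigma eps (@hform _ _ _ h).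
Proof. by case: h. Qed.

Lemma hform_nonsingular : nonsingular (@hform _ _ _ h).
Proof. by case: h. Qed.

Lemma hformDl (x y z : h) : hform (x + y) z = hform x z + hform y z.
Proof. by case: hform_hermitian. Qed.

Lemma hformDr (x y z : h) : hform x (y + z) = hform x y + hform x z.
Proof. by case: hform_hermitian. Qed.

Lemma hform_sesqui (x y : h) a b :
  hform (x <* a) (y <* b) = sigma a * hform x y * b.
Proof. by case: hform_hermitian. Qed.

Lemma hformC (x y : h) : hform y x = sigma (hform x y) *~ eps.
Proof. by case: hform_hermitian. Qed.

Lemma hform0r (x : h) : hform x 0 = 0.
Proof. by apply: (addIr (hform x 0)); rewrite -hformDr !add0r. Qed.

Lemma hform0l (x : h) : hform 0 x = 0.
Proof. by apply: (addIr (hform 0 x)); rewrite -hformDl !add0r. Qed.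

End HermFacts.

(** * Orthogonal sums and Morita equivalences *)

(** Only the two projections are recorded, not a literal product module, because a Morita
    equivalence produces the sum only up to isometry. *)
Definition orthogonal_sum (R : pzRingType) (sigma : R -> R) (eps : int)
    (l h k : herm sigma eps) : Prop :=
  exists (u : {linear l -> h}) (v : {linear l -> k}),
    [/\ forall z, u z = 0 -> v z = 0 -> z = 0,
        forall x y, exists z, u z = x /\ v z = y &
        forall z z', hform z z' = hform (u z) (u z') + hform (v z) (v z')].

Lemma orthogonal_sum_exists (R : pzRingType) (sigma : {additive R -> R})
    (h k : herm sigma 1) :
  exists l : herm sigma 1, orthogonal_sum l h k.
Proof.
pose L : lmodType R^c := (hmod h * hmod k)%type.
pose f (x y : L) : R := hform x.1 y.1 + hform x.2 y.2.
have Lfg : fg_projective L.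
  have [n [s [p sK]]] := herm_fg_projective h.
  have [n' [s' [p' sK']]] := herm_fg_projective k.
  pose S (x : L) : 'rV[R^c]_(n + n') := row_mx (s x.1) (s' x.2).
  pose Q (x : 'rV[R^c]_(n + n')) : L := (p (lsubmx x), p' (rsubmx x)).
  have SL : linear S by move=> a x y; rewrite /S /= !linearP scale_row_mx add_row_mx.
  have QL : linear Q by move=> a x y; rewrite /Q /= !linearP.
  have [[S' S'E] [Q' Q'E]] := (linear_bundle SL, linear_bundle QL).
  exists (n + n')%N, S', Q' => x.
  by rewrite S'E Q'E /Q /S row_mxKl row_mxKr sK sK'; case: x.
have fH : eps_hermitian sigma 1 f.
  split=> [x y z|x y z|x y a b|x y]; rewrite /f /=.
  + by rewrite !hformDl addrACA.
  + by rewrite !hformDr addrACA.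
  + by rewrite !hform_sesqui -mulrDl -mulrDr.
  + by rewrite hformC [hform y.2 _]hformC !mulr1z raddfD.
have Lns : nonsingular f.
  move=> g gD gZ.
  (* [g] is represented by the pair of vectors that represent its restrictions to the two
     summands. *)
  have [||x [xE xU]] := @hform_nonsingular _ _ _ h (fun x => g (x, 0)).
  + by move=> x y; rewrite -gD; congr g; congr pair; rewrite /= addr0.
  + by move=> x a; rewrite -gZ; congr g; congr pair; rewrite /ract /= scaler0.
  have [||y [yE yU]] := @hform_nonsingular _ _ _ k (fun x => g (0, x)).
  + by move=> z y; rewrite -gD; congr g; congr pair; rewrite /= addr0.
  + by move=> z a; rewrite -gZ; congr g; congr pair; rewrite /ract /= scaler0.
  exists (x, y); split=> [[z w]|[x' y'] E].
    by rewrite /f /= -xE -yE -gD; congr g; congr pair; rewrite ?addr0 ?add0r.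
  by congr pair; [apply: xU => z|apply: yU => z];
    rewrite E /f /= ?hform0r ?addr0 ?add0r.
exists (Herm Lfg fH Lns), fst, snd; split=> //=.
- by case=> a b /= -> ->.
- by move=> x y; exists (x, y).
Qed.

(** Tensoring with the Morita bimodule preserves the identities between projections and injections
    that characterise a direct sum; the splitting of the form is checked on pure tensors. *)
Lemma morita_orthogonal_sum (R S : pzRingType) (sigma : {additive R -> R})
    (tau : S -> S) (eps : int) (M : morita_equivalence sigma tau eps) (h k l : herm sigma 1) :
  orthogonal_sum l h k -> orthogonal_sum (M l) (M h) (M k).
Proof.
move=> [u [v [uv0 uvS uvE]]].
have [N [la [t [[[laD1 laZ] [laD laM la1] _ _ _] tT ts tE _]]]] :=
  mor_hermitian_morita M.
have bal h' := (tT h').1.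
(* [W] is [w] tensored with the identity of [N]. As [mor_map] acts on isometries only, projections
   and injections are transported by this construction instead. *)
have Fmap (h1 h2 : herm sigma 1) (w : {linear h1 -> h2}) :
    exists W : {linear M h1 -> M h2}, forall m n, W (t h1 m n) = t h2 (w m) n.
  apply: (tensor_linear (tT h1)) => //; have [b1 b2 b3] := bal h2.
  by split=> *; rewrite -?b3 ?raddfD ?b1 ?b2 //= /ract linearZ.
have [i [iu iv]] : exists i : {linear h -> l},
    (forall x, u (i x) = x) /\ forall x, v (i x) = 0.
  have [i iE] := choice (fun x => uvS x 0).
  have iL : linear i.
    move=> a x y; apply/eqP; rewrite -subr_eq0; apply/eqP/uv0;
      rewrite linearB linearP /=.
      by rewrite !(iE _).1 subrr.
    by rewrite !(iE _).2 scaler0 !add0r oppr0.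
  have [i' i'E] := linear_bundle iL.
  by exists i'; split=> x; rewrite i'E; case: (iE x).
have [i' [i'u i'v]] : exists i : {linear k -> l},
    (forall x, u (i x) = 0) /\ forall x, v (i x) = x.
  have [j jE] := choice (fun x => uvS 0 x).
  have jL : linear j.
    move=> a x y; apply/eqP; rewrite -subr_eq0; apply/eqP/uv0;
      rewrite linearB linearP /=.
      by rewrite !(jE _).1 scaler0 !add0r oppr0.
    by rewrite !(jE _).2 subrr.
  have [j' j'E] := linear_bundle jL.
  by exists j'; split=> x; rewrite j'E; case: (jE x).
have iuE z : i (u z) + i' (v z) = z.
  apply/eqP; rewrite -subr_eq0; apply/eqP/uv0; rewrite linearB linearD /=.
    by rewrite iu i'u addr0 subrr.
  by rewrite iv i'v add0r subrr.
have [U UE] := Fmap _ _ u; have [V VE] := Fmap _ _ v.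
have [I IE] := Fmap _ _ i; have [J JE] := Fmap _ _ i'.
have t0 h1 n : t h1 0 n = 0.
  by have [b1 _ _] := bal h1; apply: (addIr (t h1 0 n)); rewrite -b1 !add0r.
exists U, V; split.
(* The image of [i u + i' v = id] gives joint injectivity of [U] and [V]; the images of the other
   biproduct identities give joint surjectivity. *)
- have E : (fun z => I (U z) + J (V z)) =1 id.
    apply: (tensor_ext (tT l)) => // [x y|m n]; first by rewrite !raddfD addrACA.
    by rewrite UE VE IE JE; have [b1 _ _] := bal l; rewrite -b1 iuE.
  by move=> z Uz Vz; rewrite -[z]E Uz Vz !raddf0 addr0.
- have UI : (fun z => U (I z)) =1 id.
    by apply: (tensor_ext (tT h)) => [x y|//|m n]; rewrite ?raddfD // IE UE iu.
  have VJ : (fun z => V (J z)) =1 id.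
    by apply: (tensor_ext (tT k)) => [x y|//|m n]; rewrite ?raddfD // JE VE i'v.
  have UJ : (fun z => U (J z)) =1 (fun=> 0).
    by apply: (tensor_ext (tT k)) => [x y|x y|m n];
      rewrite ?raddfD ?addr0 // JE UE i'u t0.
  have VI : (fun z => V (I z)) =1 (fun=> 0).
    by apply: (tensor_ext (tT h)) => [x y|x y|m n];
      rewrite ?raddfD ?addr0 // IE VE iv t0.
  move=> x y; exists (I x + J y); rewrite !linearD /=.
  by rewrite (UI x) (VJ y) (UJ y) (VI x) add0r addr0.
move=> z z'; apply: (tensor_ext (f := hform z)
  (g := fun z' => hform (U z) (U z') + hform (V z) (V z')) (tT l))
  => [x y|x y|m' n' {z'}].
- by rewrite hformDr.
- by rewrite !raddfD !hformDr addrACA.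
apply: (tensor_ext (f := fun z => hform z (t l m' n'))
  (g := fun z => hform (U z) (U (t l m' n')) + hform (V z) (V (t l m' n')))
  (tT l)) => [x y|x y|m n {z}].
- by rewrite hformDl.
- by rewrite !raddfD !hformDl addrACA.
by rewrite !UE !VE !tE uvE laD hformDr.
Qed.

(** * Division rings and positive involutions *)

Definition division_ring (D : nzRingType) : Prop :=
  forall x : D, x != 0 -> exists y, x * y = 1 /\ y * x = 1.

(** Gaussian elimination by induction on the number of equations; coefficients stand to the left of
    the unknowns, so the pivot is inverted from the left. *)
Lemma underdetermined (D : nzRingType) : division_ring D ->
  forall (n m : nat) (A : 'I_n -> 'I_m -> D), (n < m)%N ->
  exists v : 'I_m -> D,
    (exists j, v j != 0) /\ forall i, \sum_j A i j * v j = 0.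
Proof.
move=> Ddiv; elim=> [|n IHn] [//|m] A nm.
  by exists (fun=> 1); split; [exists ord0; apply: oner_neq0|case].
have [/existsP[j0 a0]|/existsPn A0] := boolP [exists j, A ord0 j != 0]; last first.
  have [v [vN vA]] := IHn m.+1 (fun i => A (lift ord0 i)) (ltnW nm).
  exists v; split=> // i; case: (unliftP ord0 i) => [i'|] ->; first exact: vA.
  by apply: big1 => j _; have /negbNE/eqP-> := A0 j; rewrite mul0r.
have [b [ab ba]] := Ddiv _ a0.
(* Subtracting multiples of the first row clears column [j0], leaving [n] equations in the [m] other
   unknowns. *)
have [v [[j vj] vA]] := IHn m
  (fun i j =>
    A (lift ord0 i) (lift j0 j) - A (lift ord0 i) j0 * b * A ord0 (lift j0 j)) nm.
(* The value that the first equation forces on the pivot unknown. *)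
pose c := - (b * \sum_j A ord0 (lift j0 j) * v j).
pose w k := if unlift j0 k is Some k' then v k' else c.
have wS (f : 'I_m.+1 -> D) :
    \sum_k f k * w k = f j0 * c + \sum_k f (lift j0 k) * v k.
  rewrite (bigD1_ord j0) //= /w unlift_none; congr (_ + _).
  by apply: eq_bigr => k _; rewrite liftK.
exists w; split; first by exists (lift j0 j); rewrite /w liftK.
move=> i; rewrite wS /c; case: (unliftP ord0 i) => [i'|] ->; last first.
  by rewrite mulrN mulrA ab mul1r addNr.
rewrite -[RHS](vA i') mulrN !mulrA mulr_sumr -sumrN -big_split /=.
by apply: eq_bigr => k _; rewrite mulrBl addrC !mulrA.
Qed.

(** These properties are shared by the real, quaternion and complex targets. [posinv_sym] lets
    diagonal entries be scaled to 1 or -1; [posinv_aniso] is the definiteness behind inertia. *)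
Record positive_involution (D : nzRingType) (theta : {additive D -> D}) : Prop := {
  posinv_div : division_ring D;
  posinvM : forall x y, theta (x * y) = theta y * theta x;
  posinvK : involutive theta;
  posinv_sym : forall a, theta a = a ->
    exists c, a = theta c * c \/ a = - (theta c * c);
  posinv_aniso : forall (I : finType) (c : I -> D),
    \sum_i theta (c i) * c i = 0 -> forall i, c i = 0 }.

(** * Sylvester's law of inertia over a positive involution *)

Section Signature.
Variables (D : nzRingType) (theta : {additive D -> D}).
Hypothesis pos : positive_involution theta.

Lemma ractE n (x : 'rV[D^c]_n) (a : D) i :
  ((x <* a) ord0 i : D) = (x ord0 i : D) * a.
Proof. by rewrite /ract mxE. Qed.

Definition dotp n (x y : 'rV[D^c]_n) : D :=
  \sum_i theta (x ord0 i : D) * (y ord0 i : D).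

(** Up to isometry, [h] is the sum of [p] copies of <1> and [q] copies of <-1>, with coordinates [u]
    and [v]. *)
Definition signature_type (h : herm theta 1) (p q : nat) : Prop :=
  exists (u : {linear h -> 'rV[D^c]_p}) (v : {linear h -> 'rV[D^c]_q}),
    [/\ forall x, u x = 0 -> v x = 0 -> x = 0,
        forall a b, exists x, u x = a /\ v x = b &
        forall x y, hform x y =
dotp (u x) (u y) - dotp (v x) (v y)].

(* If [p' < p], some [x] with [u x != 0] is killed by [u'] and [v]; for it
   [dotp (u x) (u x) + dotp (v' x) (v' x) = 0]. *)
Lemma inertia (V : lmodType D^c) (p q p' q' : nat)
    (u : {linear V -> 'rV[D^c]_p}) (v : {linear V -> 'rV[D^c]_q})
    (u' : {linear V -> 'rV[D^c]_p'}) (v' : {linear V -> 'rV[D^c]_q'}) :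
  (forall a b, exists x, u x = a /\ v x = b) ->
  (forall x, dotp (u x) (u x) - dotp (v x) (v x) =
             dotp (u' x) (u' x) - dotp (v' x) (v' x)) ->
  (p <= p')%N.
Proof.
move=> uvS uvE.
rewrite leqNgt; apply/negP => ltp.
(* Combinations of these lifts of the standard basis are killed by [v] by construction, which leaves
   the [p'] equations [u' x = 0] in [p] unknowns. *)
have [e eE] := choice (fun i : 'I_p => uvS (\row_j ((i == j)%:R : D)) 0).
have [c [[j cj] cE]] := underdetermined (posinv_div pos)
  (fun i' i => (u' (e i) ord0 i' : D)) ltp.
pose x := \sum_i e i <* c i.
have xE n (w : {linear V -> 'rV[D^c]_n}) k :
    (w x ord0 k : D) = \sum_i (w (e i) ord0 k : D) * c i.
  by rewrite /x linear_sum summxE; apply: eq_bigr => i _; rewrite /ract linearZ mxE.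
have ux k : (u x ord0 k : D) = c k.
  rewrite xE (bigD1 k) //= (eE k).1 mxE eqxx mul1r big1 ?addr0 // => i /negbTE ik.
  by rewrite (eE i).1 mxE ik mul0r.
have vx k : (v x ord0 k : D) = 0.
  by rewrite xE big1 // => i _; rewrite (eE i).2 mxE mul0r.
have u'x k : (u' x ord0 k : D) = 0 by rewrite xE cE.
have := uvE x; rewrite /dotp; under [X in _ = X - _] eq_bigr do rewrite u'x mulr0.
rewrite [X in _ = X - _]big1 // sub0r.
under [X in _ - X = _]eq_bigr do rewrite vx mulr0.
rewrite [X in _ - X = _]big1 // subr0 => /eqP; rewrite -subr_eq0 opprK => /eqP E.
(* The sum type joins [u x] and [v' x] into one family whose hermitian squares add up to zero. *)
pose d (k : 'I_p + 'I_q') : D :=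
  match k with inl k => u x ord0 k | inr k => v' x ord0 k end.
have := posinv_aniso pos (c := d); rewrite big_sumType /= => /(_ E (inl j)) /= E'.
by rewrite -ux E' eqxx in cj.
Qed.

(** Inertia in both directions settles the positive parts; for the negative parts it is applied to
    the opposite form, which exchanges [u] and [v]. *)
Lemma signature_type_unique (h : herm theta 1) p q p' q' :
  signature_type h p q -> signature_type h p' q' -> p = p' /\ q = q'.
Proof.
suff le p1 q1 p2 q2 : signature_type h p1 q1 -> signature_type h p2 q2 ->
    (p1 <= p2)%N /\ (q1 <= q2)%N.
  move=> h1 h2; have [? ?] := le _ _ _ _ h1 h2; have [? ?] := le _ _ _ _ h2 h1.
  by split; apply/eqP; rewrite eqn_leq; apply/andP.
move=> [u [v [_ uvS uvE]]] [u' [v' [_ _ uvE']]]; split.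
  apply: (inertia (u := u) (v := v) (u' := u') (v' := v') uvS) => x.
  by rewrite -[LHS]uvE -[RHS]uvE'.
apply: (inertia (u := v) (v := u) (u' := v') (v' := u')) => [b a|x].
  by have [x [xa xb]] := uvS a b; exists x.
by rewrite -[LHS]opprB -[RHS]opprB; congr (- _); rewrite -[LHS]uvE -[RHS]uvE'.
Qed.

(** * Diagonalization and the value of the signature *)

Definition diagonal_form n (alpha : 'I_n -> int) (x y : 'rV[D^c]_n) : D :=
  \sum_i theta (x ord0 i : D) * (alpha i)%:~R * (y ord0 i : D).

Lemma posinv1 : theta 1 = 1.
Proof.
by rewrite -[LHS]mul1r -{1}[1](posinvK pos) -(posinvM pos) mul1r (posinvK pos).
Qed.

Lemma diagonal_herm n (alpha : 'I_n -> int) :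
  (forall i, alpha i = 1 \/ alpha i = -1) ->
  exists h : herm theta 1, diagonalization h alpha.
Proof.
move=> aP.
have thetaa i : theta (alpha i)%:~R = (alpha i)%:~R.
  by case: (aP i) => ->; rewrite ?mulrN1z ?raddfN posinv1.
have aa i : (alpha i)%:~R * (alpha i)%:~R = 1 :> D.
  by case: (aP i) => ->; rewrite ?mulrN1z ?mulrNN mul1r.
have aC i (x : D) : x * (alpha i)%:~R = (alpha i)%:~R * x.
  by rewrite mulrzr mulrzl.
have fg : fg_projective 'rV[D^c]_n.
  by exists n, idfun, idfun.
have herm : eps_hermitian theta 1 (diagonal_form alpha).
  rewrite /diagonal_form; split=> [x y z|x y z|x y a b|x y].
  - rewrite -big_split; apply: eq_bigr => i _ /=.
    by rewrite mxE raddfD !mulrDl.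
  - rewrite -big_split; apply: eq_bigr => i _ /=.
    by rewrite mxE mulrDr.
  - rewrite mulr_sumr mulr_suml; apply: eq_bigr => i _.
    rewrite (ractE x a i) (ractE y b i). by rewrite (posinvM pos) !mulrA.
  - rewrite mulr1z raddf_sum; apply: eq_bigr => i _.
    by rewrite !(posinvM pos) (posinvK pos) thetaa mulrA.
have ns : nonsingular (diagonal_form alpha).
  move=> f fD fZ.
  have f0 : f 0 = 0 by apply: (addIr (f 0)); rewrite -fD !add0r.
  have fS (I : finType) (F : I -> 'rV[D^c]_n) : f (\sum_i F i) = \sum_i f (F i).
    by apply: (big_morph f fD f0).
  pose e i : 'rV[D^c]_n := delta_mx ord0 i.
  have de x i : diagonal_form alpha x (e i) = theta (x ord0 i : D) * (alpha i)%:~R.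
    rewrite /diagonal_form (bigD1 i) //= mxE !eqxx mulr1.
    rewrite big1 ?addr0 // => k /negbTE ki.
    by rewrite mxE eqxx ki mulr0.
  exists (\row_i theta (f (e i) * (alpha i)%:~R)); split=> [y|x fx].
    rewrite [in LHS](row_sum_delta y) fS; apply: eq_bigr => i _.
    by rewrite fZ mxE (posinvK pos) -[_ * _ * (alpha i)%:~R]mulrA aa mulr1.
  by apply/rowP => i; rewrite mxE fx de -mulrA aa mulr1 (posinvK pos).
exists (Herm fg herm ns); split=> //; exists idfun; split=> //.
by exists idfun.
Qed.

(** Serves both the independence of an orthonormal family and the projection onto its span;
    orthonormal allows the values 1 and -1. *)
Lemma orthonormal_sum (h : herm theta 1) n (e : 'I_n -> h) (alpha : 'I_n -> int)
    (c : 'I_n -> D) i :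
  (forall j k, hform (e j) (e k) = if j == k then (alpha j)%:~R else 0) ->
  hform (e i) (\sum_j e j <* c j) = (alpha i)%:~R * c i.
Proof.
move=> eE.
have hS (F : 'I_n -> h) : hform (e i) (\sum_j F j) = \sum_j hform (e i) (F j).
  by apply: (big_morph (hform (e i))); [apply: hformDr|apply: hform0r].
have act1 (x : h) : x <* 1 = x by rewrite /ract scale1r.
have hZ j a : hform (e i) (e j <* a) = hform (e i) (e j) * a.
  by rewrite -[e i]act1 hform_sesqui posinv1 mul1r act1.
rewrite hS (bigD1 i) //= hZ eE eqxx big1 ?addr0 // => j ji.
by rewrite hZ eE eq_sym (negbTE ji) mul0r.
Qed.

(** Gram-Schmidt: the family grows while its orthogonal complement contains an anisotropic vector.
    Once there is none, polarization and nonsingularity make the complement zero, and the family is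
    a basis. *)
Lemma diagonalization_exists (h : herm theta 1) :
  exists n (alpha : 'I_n -> int), diagonalization h alpha.
Proof.
have [N [s [p sK]]] := herm_fg_projective h.
have act1 (x : h) : x <* 1 = x by rewrite /ract scale1r.
pose onb n (e : 'I_n -> h) (alpha : 'I_n -> int) :=
  (forall i, alpha i = 1 \/ alpha i = -1) /\
  forall i j, hform (e i) (e j) = if i == j then (alpha i)%:~R else 0.
have sq n (e : 'I_n -> h) alpha : onb n e alpha ->
    forall i (x : D), (alpha i)%:~R * ((alpha i)%:~R * x) = x.
  move=> [aP _] i x.
  by case: (aP i) => ->; rewrite ?mulrN1z ?mulNr ?mulrN ?opprK !mul1r.
(* [s] embeds [h] into a free module of rank [N], so a longer family would satisfy a nontrivial
   linear relation. *)
have bound n (e : 'I_n -> h) alpha : onb n e alpha -> (n <= N)%N.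
  move=> eO; rewrite leqNgt; apply/negP => ltN.
  have [c [[j cj] cE]] := underdetermined (posinv_div pos)
    (fun i k => (s (e k) ord0 i : D)) ltN.
  have : s (\sum_k e k <* c k) = 0.
    apply/rowP => i; rewrite linear_sum summxE mxE -[RHS](cE i).
    by apply: eq_bigr => k _; rewrite /ract linearZ mxE.
  move=> /(congr1 p); rewrite sK linear0 => E.
  have := orthonormal_sum c j eO.2; rewrite E hform0r.
  move=> /(congr1 (fun x => (alpha j)%:~R * x)).
  by rewrite (sq _ _ _ eO) mulr0 => /esym E'; rewrite E' eqxx in cj.
(* [k] is fuel: at [k = 0] the family would have [N.+1] members, one more than [bound] allows. *)
suff grow k n (e : 'I_n -> h) alpha : onb n e alpha -> (n + k = N.+1)%N ->
    exists n (alpha : 'I_n -> int), diagonalization h alpha.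
  apply: (grow N.+1 0%N (fun i => 0) (fun=> 1)) => //.
  by split=> [i|[]//]; left.
elim: k n e alpha => [|k IHk] n e alpha eO nk.
  by have := bound _ _ _ eO; rewrite -[n]addn0 nk ltnn.
have [aP eE] := eO.
pose pr x := \sum_i e i <* ((alpha i)%:~R * hform (e i) x).
have prE i x : hform (e i) (pr x) = hform (e i) x.
  by rewrite (orthonormal_sum _ _ eE) (sq _ _ _ eO).
pose U x := forall i, hform (e i) x = 0.
have hC (x y : h) : hform y x = theta (hform x y) by rewrite hformC mulr1z.
have hZl (x y : h) a : hform (x <* a) y = theta a * hform x y.
  by rewrite -[y]act1 hform_sesqui mulr1 act1.
have hZr (x y : h) a : hform x (y <* a) = hform x y * a.
  by rewrite -[x]act1 hform_sesqui posinv1 mul1r act1.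
have hBr (x y z : h) : hform x (y - z) = hform x y - hform x z.
  by apply: (addIr (hform x z)); rewrite -hformDr !subrK.
have [[x [xU xx]]|iso] := pselect (exists x, U x /\ hform x x <> 0).
  have [c cE] : exists c, hform x x = theta c * c \/ hform x x = - (theta c * c).
    by apply: (posinv_sym pos); rewrite -hC.
  have c0 : c != 0.
    by apply/eqP => c0; apply: xx; case: cE => ->; rewrite c0 mulr0 ?oppr0.
  (* Since [hform x x] is plus or minus [theta c * c], scaling [x] by the inverse of [c] gives the
     value 1 or -1. *)
  have [b [cb bc]] := posinv_div pos c0.
  have tbc : theta b * theta c = 1 by rewrite -(posinvM pos) cb posinv1.
  have [be [beP xbE]] : exists be : int, (be = 1 \/ be = -1) /\
      hform (x <* b) (x <* b) = be%:~R.
    rewrite hform_sesqui; case: cE => ->; [exists 1|exists (-1)]; split; auto.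
      by rewrite mulrA tbc mul1r cb.
    by rewrite mulrN mulrA tbc mul1r mulNr cb.
  have xbU i : hform (e i) (x <* b) = 0 by rewrite hZr xU mul0r.
  pose e' i := if unlift ord_max i is Some i' then e i' else x <* b.
  pose al' i := if unlift ord_max i is Some i' then alpha i' else be.
  apply: (IHk n.+1 e' al'); last by rewrite addSnnS.
  split=> [i|i j]; first by rewrite /al'; case: unliftP.
  rewrite /e' /al'.
  case: (unliftP ord_max i) => [i'|] -> ; case: (unliftP ord_max j) => [j'|] ->.
  - by rewrite (inj_eq lift_inj) eE.
  - by rewrite xbU eq_sym (negbTE (neq_lift _ _)).
  - by rewrite hC xbU raddf0 (negbTE (neq_lift _ _)).
  - by rewrite eqxx.
have iso0 x : U x -> hform x x = 0.
  by move=> xU; apply: contra_notP iso => xx; exists x.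
have U0 x : U x -> x = 0.
  move=> xU.
  have xy y : hform x y = 0.
    (* Testing on the complement suffices, because [x] is orthogonal to [pr y]. *)
    suff xyU z : U z -> hform x z = 0.
      have prx : hform x (pr y) = 0.
        rewrite (big_morph (hform x) (hformDr x) (hform0r x)) big1 // => i _.
        by rewrite hZr hC xU raddf0 mul0r.
      have := xyU (y - pr y); rewrite hBr prx subr0; apply => i.
      by rewrite hBr prE subrr.
    move=> zU; apply/eqP/negP => /negP xz.
    (* Polarization: [x], [z] and [x + z <* b] are all isotropic, so the two cross terms, each equal
       to 1, add up to zero, against [posinv_aniso]. *)
    have [b [xb bx]] := posinv_div pos xz.
    have /iso0 : U (x + z <* b) by move=> i; rewrite hformDr hZr xU zU mul0r addr0.
    rewrite hformDl !hformDr (iso0 x xU) add0r !hZl !hZr xb (iso0 z zU).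
    rewrite mul0r mulr0 addr0 hC -(posinvM pos) xb posinv1 => two.
    have := posinv_aniso pos (c := fun _ : bool => 1).
    rewrite big_bool /= mulr1 posinv1 => /(_ two true) /eqP.
    by rewrite oner_eq0.
  have [|| x0 [_ x0U]] := @hform_nonsingular _ _ _ h (fun=> 0).
  - by move=> *; rewrite addr0.
  - by move=> *; rewrite mul0r.
  by rewrite -(x0U x) // (x0U 0) // => y; rewrite hform0l.
have prK x : pr x = x.
  by apply/eqP; rewrite eq_sym -subr_eq0; apply/eqP/U0 => i; rewrite hBr prE subrr.
pose f (x : h) : 'rV[D^c]_n := \row_i ((alpha i)%:~R * hform (e i) x).
have fL : linear f.
  move=> a x y; apply/rowP => i; rewrite !mxE hformDr hZr mulrDr.
  by congr (_ + _); rewrite mulrA.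
have [f' f'E] := linear_bundle fL.
exists n, alpha; split=> //; exists f'; split.
  exists (fun r : 'rV[D^c]_n => \sum_i e i <* (r ord0 i : D)) => [x|r].
    by rewrite -[RHS]prK f'E; apply: eq_bigr => i _; rewrite mxE.
  by apply/rowP => i; rewrite f'E mxE (orthonormal_sum _ _ eE) (sq _ _ _ eO).
move=> x y; rewrite -{1}[x]prK hC.
rewrite (big_morph (hform y) (hformDr y) (hform0r y)) raddf_sum.
apply: eq_bigr => i _.
rewrite hZr !f'E !mxE (posinvM pos (hform y (e i))) -(hC y (e i)) -[in RHS]mulrA.
by rewrite (sq _ _ _ eO).
Qed.

Lemma diagonalization_type (h : herm theta 1) n (alpha : 'I_n -> int) :
  diagonalization h alpha ->
  signature_type h #|[set i | alpha i == 1]| #|[set i | alpha i != 1]|.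
Proof.
move=> [aP [f [[g fK gK] fE]]].
pose r (A : {set 'I_n}) (x : h) : 'rV[D^c]_#|A| := \row_k f x ord0 (enum_val k).
have rL A : linear (r A).
  by move=> a x y; apply/rowP => k; rewrite !mxE linearP !mxE.
have [[u uE] [v vE]] :=
  (linear_bundle (rL [set i | alpha i == 1]),
   linear_bundle (rL [set i | alpha i != 1])).
have a1 i : alpha i != 1 -> alpha i = -1 by case: (aP i) => -> //; rewrite eqxx.
pose P := [set i | alpha i == 1]; pose Q := [set i | alpha i != 1].
have fu x (i : 'I_#|P|) : f x ord0 (enum_val i) = u x ord0 i by rewrite uE mxE.
have fv x (i : 'I_#|Q|) : f x ord0 (enum_val i) = v x ord0 i by rewrite vE mxE.
exists u, v; split.
- move=> x ux vx; apply: (can_inj fK); rewrite linear0; apply/rowP => i.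
  have [iP|iQ] := boolP (i \in P).
    by rewrite -(enum_rankK_in iP iP) fu ux !mxE.
  have {}iQ : i \in Q by rewrite !inE in iQ *.
  by rewrite -(enum_rankK_in iQ iQ) fv vx !mxE.
- move=> a b.
  (* [c] interleaves [a] and [b]; the default 0 is never reached, since [P] and [Q] cover all
     indices. *)
  pose c : 'rV[D^c]_n := \row_i
    if [pick k : 'I_#|P| | enum_val k == i] is Some k then a ord0 k else
    if [pick k : 'I_#|Q| | enum_val k == i] is Some k then b ord0 k else 0.
  exists (g c); rewrite uE vE; split; apply/rowP => k; rewrite mxE gK mxE.
    by case: pickP => [k' /eqP/enum_val_inj->|/(_ k)] //; rewrite eqxx.
  case: pickP => [k' /eqP E|_].
    by have := enum_valP k; rewrite -E inE; have := enum_valP k'; rewrite inE => ->.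
  by case: pickP => [k' /eqP/enum_val_inj->|/(_ k)] //; rewrite eqxx.
move=> x y; rewrite fE (bigID (mem P)) /= -sumrN; congr (_ + _).
  rewrite big_enum_val; apply: eq_bigr => i _.
  by have := enum_valP i; rewrite !fu inE => /eqP->; rewrite mulr1.
rewrite (eq_bigl (mem Q)) => [|i]; last by rewrite !inE.
rewrite big_enum_val; apply: eq_bigr => i _.
have := enum_valP i; rewrite !fv inE => /a1->.
by rewrite mulrN1z mulrN mulr1 mulNr.
Qed.

(** [sign_diag] picks an arbitrary diagonalization, with default 0. Existence of one excludes the
    default, and inertia makes the choice immaterial. *)
Lemma sign_diagE (h : herm theta 1) p q :
  signature_type h p q -> sign_diag h = p%:Z - q%:Z.
Proof.
move=> hpq; rewrite /sign_diag.
case: xgetP => [s _ [n [alpha [hd ->]]]|no]; last first.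
  have [n [alpha hd]] := diagonalization_exists h.
  by case: (no (\sum_i alpha i)); exists n, alpha.
have [-> ->] := signature_type_unique hpq (diagonalization_type hd).
have aP := hd.1; rewrite -2!natz -!sum1_card !natr_sum.
rewrite (bigID [pred i | alpha i == 1]) /= -sumrN; congr (_ + _).
  by apply: eq_big => [i|i /eqP->//]; rewrite inE.
by apply: eq_big => [i|i]; rewrite ?inE //; case: (aP i) => ->.
Qed.

Lemma signature_type_exists (h : herm theta 1) : exists p q, signature_type h p q.
Proof.
have [n [alpha hd]] := diagonalization_exists h.
exists #|[set i | alpha i == 1]|, #|[set i | alpha i != 1]|.
exact: diagonalization_type.
Qed.

(** [eps], coerced to a number, selects [n] copies of <1> or [n] copies of <-1>. *)
Lemma signature_type_diagonal n (eps : bool) : exists h : herm theta 1,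
  signature_type h (eps * n) (~~ eps * n).
Proof.
have [|h hd] :=
  @diagonal_herm n (fun=> if eps then 1 else -1); first by case: eps; auto.
exists h; move: (diagonalization_type hd); rewrite !cardsE.
have cT : #|(fun=> true) : pred 'I_n| = n by rewrite -[RHS]card_ord; apply: eq_card.
by case: eps {hd} => /=; rewrite ?cT card0 ?mul1n.
Qed.

(** * Signature types under sums and isometries *)

Lemma signature_type_orthogonal_sum (l h k : herm theta 1) p q p' q' :
  orthogonal_sum l h k ->
  signature_type h p q -> signature_type k p' q' ->
  signature_type l (p + p') (q + q').
Proof.
move=> [w [w' [w0 wS wE]]] [u [v [uv0 uvS uvE]]] [u' [v' [uv0' uvS' uvE']]].
have fL m m' (f : {linear h -> 'rV[D^c]_m}) (f' : {linear k -> 'rV[D^c]_m'}) :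
  linear (fun x => row_mx (f (w x)) (f' (w' x))).
  by move=> a x y; rewrite !linearP scale_row_mx add_row_mx.
have dotpD m m' (a b : 'rV[D^c]_m) (a' b' : 'rV[D^c]_m') :
    dotp (row_mx a a') (row_mx b b') = dotp a b + dotp a' b'.
  rewrite /dotp big_split_ord /=; congr (_ + _); apply: eq_bigr => i _;
    by rewrite ?row_mxEl ?row_mxEr.
have [[U UE] [V VE]] := (linear_bundle (fL _ _ u u'), linear_bundle (fL _ _ v v')).
exists U, V; split.
- move=> x; rewrite UE VE -row_mx0 -[in X in _ -> X](row_mx0).
  move=> /eq_row_mx[E1 E2] /eq_row_mx[E3 E4].
  by apply: w0; [apply: uv0|apply: uv0'].
- move=> a b.
  have [x [xa xb]] := uvS (lsubmx a) (lsubmx b).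
  have [x' [xa' xb']] := uvS' (rsubmx a) (rsubmx b).
  have [z [zx zx']] := wS x x'.
  by exists z; rewrite UE VE zx zx' xa xb xa' xb' !hsubmxK.
move=> x y; rewrite wE uvE uvE' !UE !VE !dotpD opprD.
by rewrite addrACA.
Qed.

Lemma signature_type_isometry (h k : herm theta 1) p q :
  Defs.isometry h k -> signature_type k p q -> signature_type h p q.
Proof.
move=> [f [g fK gK] fE] [u [v [uv0 uvS uvE]]].
have [|U UE] := @linear_bundle _ _ _ (u \o f).
  by move=> a x y /=; rewrite !linearP.
have [|V VE] := @linear_bundle _ _ _ (v \o f).
  by move=> a x y /=; rewrite !linearP.
exists U, V; split.
- move=> x; rewrite UE VE => ux vx; apply: (can_inj fK); rewrite linear0; exact: uv0.
- by move=> a b; have [x [xa xb]] := uvS a b; exists (g x); rewrite UE VE /= gK.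
by move=> x y; rewrite -fE uvE !UE !VE.
Qed.

(** Vectors with the same coordinates are matched; joint injectivity of the coordinates makes the
    matching linear and bijective. *)
Lemma isometry_of_signature_type (h k : herm theta 1) p q :
  signature_type h p q -> signature_type k p q -> inhabited (Defs.isometry h k).
Proof.
move=> [u [v [uv0 uvS uvE]]] [u' [v' [uv0' uvS' uvE']]].
have [f fE] := choice (fun x => uvS' (u x) (v x)).
have [g gE] := choice (fun x => uvS (u' x) (v' x)).
have fL : linear f.
  move=> a x y; apply/eqP; rewrite -subr_eq0; apply/eqP/uv0';
    rewrite linearB linearP.
    by rewrite !(fE _).1 linearP subrr.
  by rewrite !(fE _).2 linearP subrr.
have [f' f'E] := linear_bundle fL.
have f'bij : bijective f'.
  exists g => x; apply/eqP; rewrite -subr_eq0; apply/eqP; [apply: uv0|apply: uv0'];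
    by rewrite linearB ?(gE _).1 ?(gE _).2 f'E ?(fE _).1 ?(fE _).2
      ?(gE _).1 ?(gE _).2 subrr.
constructor; apply: (Isometry f'bij) => x y.
by rewrite uvE' uvE !f'E !(fE _).1 !(fE _).2.
Qed.

End Signature.

(** * Comparison of two Morita equivalences *)

(** The matrix with rows [(p, q)], [(p', q')] times the one with rows [(a, a')], [(b, b')] is the
    identity. Nothing can cancel over the naturals, so only permutation matrices remain. *)
Lemma nat_matrix_inverse (p q p' q' a a' b b' : nat) :
  (p * a + q * b = 1)%N -> (p * a' + q * b' = 0)%N ->
  (p' * a + q' * b = 0)%N -> (p' * a' + q' * b' = 1)%N ->
  [/\ a = 1, a' = 0, b = 0 & b' = 1]%N \/ [/\ a = 0, a' = 1, b = 1 & b' = 0]%N.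
Proof.
move=> e1 e2 e3 e4.
have [E|E] : (p * a = 1 \/ q * b = 1)%N by lia.
  move/eqP: E e1 e2 e3; rewrite muln_eq1 => /andP[/eqP-> /eqP->] e1 e2 e3.
  have p'0 : p' = 0%N by lia.
  have a'0 : a' = 0%N by lia.
  move: e4; rewrite p'0 mul0n add0n => /eqP; rewrite muln_eq1.
  move=> /andP[/eqP q'1 /eqP->].
  by left; split; lia.
move/eqP: E e1 e2 e3; rewrite muln_eq1 => /andP[/eqP-> /eqP->] e1 e2 e3.
have q'0 : q' = 0%N by lia.
have b'0 : b' = 0%N by lia.
move: e4; rewrite q'0 mul0n addn0 => /eqP; rewrite muln_eq1.
move=> /andP[/eqP p'1 /eqP->].
by right; split; lia.
Qed.

Section TwoEquivalences.
Variables (R : pzRingType) (sigma : {additive R -> R}).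
Variables (D : nzRingType) (theta : {additive D -> D}).
Hypothesis pos : positive_involution theta.
Variables M1 M2 : morita_equivalence sigma theta 1.

(** Fullness of [M1] lifts an isometry between the images to one between [h] and [k], which [M2]
    then carries over. So the type under [M1] determines the type under [M2]. *)
Lemma signature_type_transfer (h k : herm sigma 1) p q r s :
  signature_type (M1 h) p q -> signature_type (M1 k) p q ->
  signature_type (M2 k) r s -> signature_type (M2 h) r s.
Proof.
move=> h1 k1 k2; have [g] := isometry_of_signature_type h1 k1.
have [f _] := mor_full g.
exact: signature_type_isometry (mor_map M2 f) k2.
Qed.

Lemma morita_signature_type_surj (M : morita_equivalence sigma theta 1) n
    (eps : bool) :
  exists h, signature_type (M h) (eps * n) (~~ eps * n).
Proof.
have [k kT] := signature_type_diagonal pos n eps.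
have [h [g]] := mor_esssurj M k.
by exists h; apply: signature_type_isometry g kT.
Qed.

Lemma sign_diag_morita : exists delta : int, (delta = -1 \/ delta = 1) /\
  forall h, sign_diag (M1 h) = delta * sign_diag (M2 h).
Proof.
(* [e] and [e'] correspond under [M1] to <1> and <-1>; their types under [M2] are the rows of the
   matrix of the induced map on types. *)
have [e eT] := morita_signature_type_surj M1 1 true.
have [e' eT'] := morita_signature_type_surj M1 1 false.
have [a [a' aT]] := signature_type_exists pos (M2 e).
have [b [b' bT]] := signature_type_exists pos (M2 e').
have add h k p q p' q' r s r' s' :
    signature_type (M1 h) p q -> signature_type (M2 h) r s ->
    signature_type (M1 k) p' q' -> signature_type (M2 k) r' s' ->
    exists l, signature_type (M1 l) (p + p') (q + q') /\
              signature_type (M2 l) (r + r') (s + s').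
  move=> h1 h2 k1 k2; have [l lO] := orthogonal_sum_exists h k.
  exists l; split.
    exact: signature_type_orthogonal_sum (morita_orthogonal_sum M1 lO) h1 k1.
  exact: signature_type_orthogonal_sum (morita_orthogonal_sum M2 lO) h2 k2.
have lin p q : exists h, signature_type (M1 h) p q /\
    signature_type (M2 h) (p * a + q * b) (p * a' + q * b').
  elim: p => [|p [h [h1 h2]]]; last first.
    have [l [l1 l2]] := add _ _ _ _ _ _ _ _ _ _ eT aT h1 h2.
    by exists l; rewrite !mulSn -!addnA.
  elim: q => [|q [h [h1 h2]]]; last first.
    have [l [l1 l2]] := add _ _ _ _ _ _ _ _ _ _ eT' bT h1 h2.
    by exists l; rewrite !mulSn !addnA !addn0 in l2 *.
  (* Base case: [z] and its sum with itself both have type [(0, 0)] under [M1], hence equal types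
     under [M2], so [c + c = c] and [c' + c' = c']. *)
  have [z zT] := morita_signature_type_surj M1 0 true.
  have [c [c' cT]] := signature_type_exists pos (M2 z).
  have [l [l1 l2]] := add _ _ _ _ _ _ _ _ _ _ zT cT zT cT.
  have lT := signature_type_transfer l1 zT cT.
  have [c0 c'0] := signature_type_unique pos l2 lT.
  have {}c0 : c = 0 by lia.
  have {}c'0 : c' = 0 by lia.
  by exists z; rewrite c0 c'0 in cT.
have M2T h p q : signature_type (M1 h) p q ->
    signature_type (M2 h) (p * a + q * b) (p * a' + q * b').
  by move=> h1; have [k [k1 k2]] := lin p q; apply: signature_type_transfer h1 k1 k2.
(* The types under [M1] of preimages under [M2] of <1> and <-1> form the inverse matrix. *)
have [k kT] := morita_signature_type_surj M2 1 true.
have [k' kT'] := morita_signature_type_surj M2 1 false.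
have [p [q /M2T/(signature_type_unique pos kT)[/esym E1 /esym E2]]] :=
  signature_type_exists pos (M1 k).
have [p' [q' /M2T/(signature_type_unique pos kT')[/esym E3 /esym E4]]] :=
  signature_type_exists pos (M1 k').
have [] := nat_matrix_inverse E1 E2 E3 E4 => -[Ea Ea' Eb Eb'].
  exists 1; split; first by right.
  move=> h; have [r [s hT]] := signature_type_exists pos (M1 h).
  rewrite (sign_diagE pos hT) (sign_diagE pos (M2T _ _ _ hT)); lia.
exists (-1); split; first by left.
move=> h; have [r [s hT]] := signature_type_exists pos (M1 h).
rewrite (sign_diagE pos hT) (sign_diagE pos (M2T _ _ _ hT)); lia.
Qed.

End TwoEquivalences.

(** * Positivity of the target involutions *)

(** [theta x] divided by the norm inverts [x]; symmetric elements are scalars, hence plus or minus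
    squares as [K] is real closed; a vanishing sum of nonnegative norms has vanishing terms. *)
Lemma positive_involution_norm (K : rcfType) (D : nzRingType)
    (theta : {additive D -> D}) (i : {rmorphism K -> D}) (N : D -> K) :
  (forall x y, theta (x * y) = theta y * theta x) -> involutive theta ->
  (forall x a, i a * x = x * i a) ->
  (forall a, theta a = a -> exists x, a = i x) -> (forall x, theta (i x) = i x) ->
  (forall x, theta x * x = i (N x)) -> (forall x, x * theta x = i (N x)) ->
  (forall x, 0 <= N x) -> (forall x, N x = 0 -> x = 0) ->
  positive_involution theta.
Proof.
move=> thM thK iC symi thi Nl Nr N0 Nx; split=> //.
- move=> x x0; have nx : N x != 0.
    by apply/negP => /eqP /Nx xz; rewrite xz eqxx in x0.
  exists (theta x * i (N x)^-1); split.
    by rewrite mulrA Nr -rmorphM divff ?rmorph1.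
  by rewrite -mulrA iC mulrA Nl -rmorphM divff ?rmorph1.
- move=> a /symi[x ->]; have [x0|x0] := lerP 0 x.
    exists (i (Num.sqrt x)); left; by rewrite thi -rmorphM -expr2 sqr_sqrtr.
  exists (i (Num.sqrt (- x))); right.
  by rewrite thi -rmorphM -expr2 sqr_sqrtr ?oppr_ge0 ?ltW // raddfN opprK.
move=> I c E.
have NE : \sum_k N (c k) = 0.
  apply: (fmorph_inj i); rewrite rmorph0 -[RHS]E rmorph_sum.
  by apply: eq_bigr => k _; rewrite Nl.
by move=> k; apply: Nx; apply: (psumr_eq0P (fun k _ => N0 (c k)) NE).
Qed.

(** The norms are the square, the quaternion norm and the squared modulus. The split ring is
    excluded, as it has zero divisors. *)
Lemma tinv_positive (K : rcfType) (T : target) : T <> TSplit ->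
  exists theta : {additive tring K T -> tring K T},
    (theta : _ -> _) = @tinv K T /\ positive_involution theta.
Proof.
case: T => // _.
- exists idfun; split=> //.
  apply: (@positive_involution_norm K K idfun idfun (fun x => x ^+ 2)) => //=.
  + by move=> x y; rewrite mulrC.
  + by move=> x a; rewrite mulrC.
  + by move=> a _; exists a.
  + by move=> x; rewrite sqr_ge0.
  + by move=> x /eqP; rewrite sqrf_eq0 => /eqP.
- have aC : zmod_morphism (@quat_conj K).
    by move=> [a b c d] [a' b' c' d']; congr Quat; rewrite /= opprD.
  pose th : {additive quat K -> quat K} :=
    HB.pack_for {additive quat K -> quat K} (@quat_conj K)
      (GRing.isZmodMorphism.Build _ _ _ aC).
  pose qi (x : K) : quat K := Quat x 0 0 0.
  have iB : zmod_morphism qi by move=> x y; congr Quat; rewrite /= subr0.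
  have iM : GRing.monoid_morphism qi.
    split=> [//|x y]; congr Quat => /=; ring.
  pose i : {rmorphism K -> quat K} :=
    HB.pack_for {rmorphism K -> quat K} qi (GRing.isZmodMorphism.Build _ _ _ iB)
      (GRing.isMonoidMorphism.Build _ _ _ iM).
  exists th; split=> //.
  apply: (@positive_involution_norm K (quat K) th i
    (fun x => q1 x ^+ 2 + Defs.qi x ^+ 2 + qj x ^+ 2 + qk x ^+ 2)) => //=.
  + by move=> [? ? ? ?] [? ? ? ?]; congr Quat => /=; ring.
  + by move=> [? ? ? ?]; congr Quat; rewrite /= opprK.
  + by move=> [? ? ? ?] a; congr Quat => /=; ring.
  + move=> [a b c d] [bE cE dE]; exists a; congr Quat; lra.
  + by move=> x; congr Quat; rewrite /= oppr0.
  + by move=> [? ? ? ?]; congr Quat => /=; ring.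
  + by move=> [? ? ? ?]; congr Quat => /=; ring.
  + by move=> x; rewrite !addr_ge0 ?sqr_ge0.
  + move=> [a b c d] /= /eqP; rewrite !paddr_eq0 ?addr_ge0 ?sqr_ge0 // !sqrf_eq0.
    by move=> /andP[/andP[/andP[/eqP-> /eqP->] /eqP->] /eqP->].
exists (@conjc K); split=> //.
apply: (@positive_involution_norm K (complex K) (@conjc K) (real_complex K)
  (fun x => complex.Re x ^+ 2 + complex.Im x ^+ 2)) => /=.
- by move=> x y; rewrite rmorphM mulrC.
- exact: conjcK.
- by move=> x a; rewrite mulrC.
- by move=> [a b] [bE]; exists a; congr Complex; lra.
- exact: conjc_real.
- by move=> [a b]; congr Complex => /=; ring.
- by move=> [a b]; congr Complex => /=; ring.
- by move=> x; rewrite addr_ge0 ?sqr_ge0.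
move=> [a b] /= /eqP; rewrite paddr_eq0 ?sqr_ge0 // !sqrf_eq0.
by move=> /andP[/eqP-> /eqP->].
Qed.

(** * The signature of Morita images *)

(** For the split target, and for real or quaternion targets with [eps] other than 1, both
    signatures are zero. The hypothesis concerns [TComplex] because there [sign] is [sign_diag]
    whatever [eps] is. *)
Lemma sign_morita (R : pzRingType) (sigma : {additive R -> R}) (K : rcfType)
    (T : target) (eps : int) (M1 M2 : morita_equivalence sigma (@tinv K T) eps) :
  (T = TComplex -> eps = 1) ->
  exists delta : int, (delta = -1 \/ delta = 1) /\
    forall h, Defs.sign (M1 h) = delta * Defs.sign (M2 h).
Proof.
move=> epsC; have [epsE|/negbTE eps1] := eqVneq eps 1; last first.
  exists 1; split; first by right.
  case: T M1 M2 epsC => M1 M2 epsC h; rewrite /Defs.sign ?eps1 ?mulr0 //.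
  by rewrite epsC ?eqxx in eps1.
have [TS|TS] := pselect (T = TSplit).
  exists 1; split; first by right.
  by move=> h; subst T; rewrite /Defs.sign mulr0.
subst eps.
have signE (h : herm (@tinv K T) 1) : Defs.sign h = sign_diag h.
  by case: T h TS {epsC M1 M2}.
have [theta [thE pos]] := tinv_positive K TS.
suff [delta [dP dE]] : exists delta : int, (delta = -1 \/ delta = 1) /\
    forall h, sign_diag (M1 h) = delta * sign_diag (M2 h).
  by exists delta; split=> // h; rewrite !signE.
(* The types of [M1] and [M2] depend on [tinv], so both are generalized before the equality replaces
   it by the bundled [theta]. *)
by move: M1 M2 {signE}; case: _ / thE => M1 M2; apply: sign_diag_morita pos M1 M2.
Qed.

Theorem proposition3p4
  (F : fieldType) (F_real : formally_real F)
  (A : falgType F) (sigma : {linear A -> A})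
  (A_inv : algebra_with_involution sigma)
  (P : set F) (P_ord : is_ordering P)
  (FP : rcfType) (iota : {rmorphism F -> FP})
  (iota_closure : is_real_closure P iota)
  (AP : algType FP) (j : {rmorphism A -> AP}) (sigmaP : {linear AP -> AP})
  (AP_ext : is_scalar_extension sigma iota j sigmaP)
  (T : target) (T_target : is_target P sigma AP T)
  (M1 M2 : morita_equivalence sigmaP (@tinv FP T) (eps_target sigma T)) :
  exists delta : int, (delta = -1 \/ delta = 1) /\
    forall (h : herm sigma 1) (hP : herm sigmaP 1),
      is_base_change j h hP -> sign (M1 hP) = delta * sign (M2 hP).
Proof.
have [|delta [dP dE]] := sign_morita M1 M2.
  (* [eps_target] can be -1 only for [TReal] and [TQuat]. *)
  by move=> ->; rewrite /eps_target asboolF // => -[[]|[]].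
by exists delta; split=> // h hP _; apply: dE.
Qed.
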